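(* Fix $0<\mu<L$, integers $n\ge2$ and $d\ge1$, put $\kappa=L/\mu$, and fix any map $M$ that compresses a departing node into a function $M(y,\nabla f(y))$ of one first-order snapshot $(y,\nabla f(y))\in\mathbb R^d\times\mathbb R^d$. For every $\varepsilon>0$ there exist two instances, i.e. survivors' functions $f_1,\dots,f_{n-1}$ (the same in both instances) and departing functions $f$ and $\tilde f$, all functions $\mathbb R^d\to\mathbb R$ being $\mu$-strongly convex and $L$-smooth, and a point $y\in\mathbb R^d$, such that the snapshots coincide, $\nabla f(y)=\nabla\tilde f(y)$, and, with $x^\star=\arg\min\big(\sum_{j<n}f_j+f\big)$ and $\tilde x^\star=\arg\min\big(\sum_{j<n}f_j+\tilde f\big)$, $$\|y-x^\star\|=\Theta(\varepsilon),\qquad \|y-\tilde x^\star\|=\Theta(\varepsilon),\qquad \|x^\star-\tilde x^\star\|=\frac{(L-\mu)\varepsilon}{(n-1)\mu+L},$$ where the constants in $\Theta(\cdot)$ may depend on $\mu,L,n$ but not on $\varepsilon$. Hence the worst-case bias of any method whose limit point is a function only of the memory $M(y,\nabla f(y))$ and of the survivors' functions is $\Omega\big(\frac{(\kappa-1)\varepsilon}{n+\kappa}\big)$: there is an absolute constant $c>0$ such that on at least one of the two instances the distance of the method's limit point to that instance's true minimizer is at least $c\,\frac{(\kappa-1)\varepsilon}{n+\kappa}$. In particular, a bias guarantee of $\frac{\kappa-1}{2n}\varepsilon$ (that of Legacy-GT) is optimal up to a factor $O(\kappa)$: it exceeds this lower bound by at most a factor $C\kappa$ with $C$ an absolute 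constant.
   Context: An instance is a decentralized problem $\min_x\sum_{i=1}^nf_i(x)$ over $\mathbb R^d$ in which one node departs permanently after leaving behind a memory that depends only on a single first-order snapshot $(y,\nabla f(y))$ of its function $f$; the remaining $n-1$ nodes are the survivors. The bias of a method on an instance is the Euclidean distance from its limit point to the true minimizer of the full sum (including the departed function). $\mu$-strongly convex and $L$-smooth have their usual meaning for differentiable functions ($f-\frac\mu2\|\cdot\|^2$ convex, $f-\frac L2\|\cdot\|^2$ concave). Legacy-GT is the method in which the departing node is replaced by the quadratic $f(y)+\langle\nabla f(y),x-y\rangle+\frac{\mu+L}{4}\|x-y\|^2$. *)

(* Defs.v *)
From HB Require Import structures.
From mathcomp Require Export all_boot all_order all_algebra.
From mathcomp Require Export all_classical all_reals all_analysis.
Export numFieldNormedType.Exports.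

Set Implicit Arguments.
Unset Strict Implicit.
Unset Printing Implicit Defensive.

Import Order.TTheory GRing.Theory Num.Theory.
Local Open Scope classical_set_scope.
Local Open Scope ring_scope.

Section Definitions.
Context {R : realType}.

Definition dot {d : nat} (u v : 'rV[R]_d) : R := \sum_(i < d) u 0 i * v 0 i.

(* The library's norm on 'rV[R]_d is the sup norm; it is used below only
   through [differentiable] and 'D, where any equivalent norm will do. *)
Definition enorm {d : nat} (u : 'rV[R]_d) : R := Num.sqrt (dot u u).

Definition gradient {d : nat} (f : 'rV[R]_d -> R) (x : 'rV[R]_d) : 'rV[R]_d :=
  \row_i 'D_(delta_mx 0 i) (f : 'rV[R]_d -> R^o) x.

Definition convex {d : nat} (f : 'rV[R]_d -> R) : Prop :=
  convex_function (E := 'rV[R]_d) setT (f : 'rV[R]_d -> R^o).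

Definition concave {d : nat} (f : 'rV[R]_d -> R) : Prop :=
  convex (fun x => - f x).

Definition strongly_convex {d : nat} (mu : R) (f : 'rV[R]_d -> R) : Prop :=
  convex (fun x => f x - mu / 2 * enorm x ^+ 2).

Definition smooth {d : nat} (L : R) (f : 'rV[R]_d -> R) : Prop :=
  concave (fun x => f x - L / 2 * enorm x ^+ 2).

Definition admissible {d : nat} (mu L : R) (f : 'rV[R]_d -> R) : Prop :=
  [/\ forall x, differentiable (f : 'rV[R]_d -> R^o) x,
      strongly_convex mu f & smooth L f].

Definition argmin {d : nat} (F : 'rV[R]_d -> R) : set 'rV[R]_d :=
  [set x | forall z, F x <= F z].

Record instance (n d : nat) := Instance {
  survivor : 'I_n.-1 -> 'rV[R]_d -> R ;
  departed : 'rV[R]_d -> R ;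
  snapshot : 'rV[R]_d }.

Definition admissible_instance {n d : nat} (mu L : R) (I : instance n d) : Prop :=
  (forall j, admissible mu L (survivor I j)) /\ admissible mu L (departed I).

Definition objective {n d : nat} (I : instance n d) (x : 'rV[R]_d) : R :=
  \sum_(j < n.-1) survivor I j x + departed I x.

(* A method is represented by the map sending the memory and the survivors'
   functions to its limit point. *)
Definition memory_limit {n d : nat} {Mem : Type}
    (M : 'rV[R]_d -> 'rV[R]_d -> Mem)
    (A : Mem -> ('I_n.-1 -> 'rV[R]_d -> R) -> 'rV[R]_d)
    (I : instance n d) : 'rV[R]_d :=
  A (M (snapshot I) (gradient (departed I) (snapshot I))) (survivor I).

Definition legacy {d : nat} (mu L : R) (f : 'rV[R]_d -> R) (y x : 'rV[R]_d) : R :=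
  f y + dot (gradient f y) (x - y) + (mu + L) / 4 * enorm (x - y) ^+ 2.

(* The limit point of Legacy-GT on [I] is the minimizer of the objective of
   [legacy_instance mu L I]. *)
Definition legacy_instance {n d : nat} (mu L : R) (I : instance n d) :
    instance n d :=
  Instance (survivor I) (legacy mu L (departed I) (snapshot I)) (snapshot I).

End Definitions.

(* Main.v *)
(* Lower bound: the survivors are [mu / 2 * |x - p|^2], the departing function is
   [mu / 2 * |x|^2] or [L / 2 * |x|^2], and the snapshot is taken at [y = 0], where
   both gradients vanish. The minimizers are multiples of [p], and for
   [|p| = n * eps / (n - 1)] their distance is exactly the claimed one. A method
   sees the same data on both instances, so one bias is at least half of it.

   Upper bound: the Legacy-GT objective is [m]-strongly convex with
   [m = (n - 1) * mu + (mu + L) / 2 >= n * mu], and its gradient at [xstar] differs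
   from that of the true objective by at most [(L - mu) / 2 * |y - xstar|], because
   [gradient f - (mu + L) / 2 * id] is [(L - mu) / 2]-Lipschitz. *)
From mathcomp Require Import ring lra.
Require Import Defs.
Import Order.TTheory GRing.Theory Num.Theory.
Set Implicit Arguments.
Unset Strict Implicit.
Unset Printing Implicit Defensive.

Local Open Scope classical_set_scope.
Local Open Scope ring_scope.

(** * Euclidean inner product and norm *)

Section Euclidean.
Context {R : realType} {d : nat}.
Implicit Types (u v w x y z : 'rV[R]_d) (a t : R).

Lemma dotC u v : dot u v = dot v u.
Proof. by apply: eq_bigr => i _; rewrite mulrC. Qed.

Lemma dotDl u v w : dot (u + v) w = dot u w + dot v w.
Proof. by rewrite -big_split; apply: eq_bigr => i _; rewrite mxE mulrDl. Qed.

Lemma dotZl a u w : dot (a *: u) w = a * dot u w.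
Proof. by rewrite mulr_sumr; apply: eq_bigr => i _; rewrite mxE mulrA. Qed.

Lemma dotNl u w : dot (- u) w = - dot u w.
Proof. by rewrite -scaleN1r dotZl mulN1r. Qed.

Lemma dot0l w : dot 0 w = 0.
Proof. by rewrite -(scale0r 0) dotZl mul0r. Qed.

Lemma dotDr u v w : dot w (u + v) = dot w u + dot w v.
Proof. by rewrite dotC dotDl !(dotC w). Qed.

Lemma dotZr a u w : dot w (a *: u) = a * dot w u.
Proof. by rewrite dotC dotZl (dotC w). Qed.

Lemma dotNr u w : dot w (- u) = - dot w u.
Proof. by rewrite dotC dotNl (dotC w). Qed.

Lemma dot_ge0 u : 0 <= dot u u.
Proof. by apply: sumr_ge0 => i _; rewrite -expr2 sqr_ge0. Qed.

Lemma dot_eq0 u : dot u u = 0 -> u = 0.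
Proof.
move=> /eqP; rewrite psumr_eq0 => [/allP u0|i _]; last by rewrite -expr2 sqr_ge0.
apply/rowP => i; rewrite mxE; apply/eqP.
by have := u0 i (mem_index_enum i); rewrite /= mulf_eq0 orbb.
Qed.

Lemma enorm_ge0 u : 0 <= enorm u.
Proof. exact: sqrtr_ge0. Qed.

Lemma sqr_enorm u : enorm u ^+ 2 = dot u u.
Proof. by rewrite sqr_sqrtr ?dot_ge0. Qed.

Lemma enormZ a u : enorm (a *: u) = `|a| * enorm u.
Proof.
by rewrite /enorm dotZl dotZr mulrA -expr2 sqrtrM ?sqr_ge0// sqrtr_sqr.
Qed.

Lemma enorm_delta (i : 'I_d) : enorm (delta_mx 0 i : 'rV[R]_d) = 1.
Proof.
rewrite /enorm /dot (bigD1 i)//= big1 => [|j /negPf ji].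
  by rewrite addr0 mxE !eqxx mulr1 sqrtr1.
by rewrite mxE eqxx ji mul0r.
Qed.

Definition dotE := (dotDl, dotDr, dotNl, dotNr, dotZl, dotZr).

Lemma dot_convex_comb t x y :
  dot (t *: x + (1 - t) *: y) (t *: x + (1 - t) *: y) =
  t * dot x x + (1 - t) * dot y y - t * (1 - t) * dot (x - y) (x - y).
Proof. by rewrite !dotE (dotC y x); ring. Qed.

End Euclidean.

(** * Strong convexity and first-order bounds *)

Section StrongConvexity.
Context {R : realType} {d : nat}.
Implicit Types (f g S phi : 'rV[R]_d -> R) (x y z : 'rV[R]_d) (mu L s t : R).

Lemma convexP f : convex f <-> forall t x y, 0 <= t <= 1 ->
  f (t *: x + (1 - t) *: y) <= t * f x + (1 - t) * f y.
Proof.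
split=> [cf t x y /andP[t0 t1]|cf t x y _ _].
  by have := cf (Itv01 t0 t1) x y; apply; rewrite in_setT.
by apply: cf; rewrite ge0 le1.
Qed.

(** The subtracted quadratic contributes exactly the gap computed in [dot_convex_comb]. The sign of
    [s] is free, so that negative moduli can encode smoothness. *)
Lemma strongly_convexP s f : strongly_convex s f <->
  forall t x y, 0 <= t <= 1 ->
    f (t *: x + (1 - t) *: y) <=
      t * f x + (1 - t) * f y - s / 2 * (t * (1 - t) * dot (x - y) (x - y)).
Proof.
rewrite /strongly_convex convexP.
split=> cf t x y t01; have := cf t x y t01; rewrite !sqr_enorm dot_convex_comb; lra.
Qed.

(** Lets [minimizer_lower_bound] yield both the lower and the upper quadratic bounds. *)
Lemma smooth_strongly_convex L f : smooth L f <-> strongly_convex (- L) (- f).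
Proof.
rewrite /smooth /concave /strongly_convex.
suff -> : (fun x => - (f x - L / 2 * enorm x ^+ 2)) =
          (fun x => (- f) x - - L / 2 * enorm x ^+ 2) by [].
by apply: funext => x; rewrite opprfctE; ring.
Qed.

Lemma strongly_convexD s t f g : strongly_convex s f -> strongly_convex t g ->
  strongly_convex (s + t) (fun x => f x + g x).
Proof.
move=> /strongly_convexP cf /strongly_convexP cg.
apply/strongly_convexP => r x y r01.
have := cf r x y r01; have := cg r x y r01; lra.
Qed.

Lemma strongly_convex_sum s n (f : 'I_n -> 'rV[R]_d -> R) :
  (forall i, strongly_convex s (f i)) ->
  strongly_convex (n%:R * s) (fun x => \sum_(i < n) f i x).
Proof.
move=> cf; apply/strongly_convexP => t x y t01.
have {cf} := fun i => (strongly_convexP s (f i)).1 (cf i) t x y t01.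
move: (dot _ _) => D cf.
have -> : n%:R * s / 2 * (t * (1 - t) * D) = \sum_(i < n) (s / 2 * (t * (1 - t) * D)).
  by rewrite sumr_const card_ord -[RHS]mulr_natl !mulrA.
by rewrite !mulr_sumr -sumrN -!big_split/=; apply: ler_sum => i _; exact: cf.
Qed.

Lemma derive_gradient f x v :
  differentiable (f : _ -> R^o) x -> 'D_v (f : _ -> R^o) x = dot (gradient f x) v.
Proof.
move=> df; rewrite deriveE// {1}(row_sum_delta v) linear_sum; apply: eq_bigr => i _.
by rewrite linearZ/= mxE deriveE// mulrC.
Qed.

(* The first-order condition at [x0] along the segment to [z]; [S] itself need
   not be differentiable. *)
Lemma minimizer_lower_bound s S phi x0 z :
  strongly_convex s S -> differentiable (phi : _ -> R^o) x0 ->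
  (forall x, S x0 + phi x0 <= S x + phi x) ->
  S x0 - dot (gradient phi x0) (z - x0) + s / 2 * dot (z - x0) (z - x0) <= S z.
Proof.
move=> /strongly_convexP cS dphi min0.
rewrite -derive_gradient//; set v := z - x0; set D := 'D_v _ _.
have psiD : (fun t : R => t^-1 * (phi (t *: v + x0) - phi x0)) @ 0^'+ --> D.
  exact: cvg_dnbhs_at_right (diff_derivable dphi).
(* For [0 < t <= 1], strong convexity at [t *: v + x0] and minimality of [x0], divided by [t], bound
   the expression under the limit by [S z]. The claim follows as [t] tends to 0. *)
have lim0 : (fun t : R => S x0 - t^-1 * (phi (t *: v + x0) - phi x0)
    + s / 2 * ((1 - t) * dot v v)) @ 0^'+ --> S x0 - D + s / 2 * dot v v.
  apply: cvgD; first by apply: cvgB => //; exact: cvg_cst.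
  apply: cvgMl_tmp; rewrite -[X in _ --> X]mul1r; apply: cvgMr_tmp.
  rewrite -[X in _ --> X]subr0; apply: cvgB; first exact: cvg_cst.
  exact: cvg_at_right_filter cvg_id.
rewrite -(cvg_lim _ lim0)//; apply: limr_le; first exact: cvgP lim0.
near=> t.
have t0 : 0 < t by [].
have t1 : t <= 1 by near: t; apply: nbhs_right_le.
have := cS t z x0; rewrite t1 ltW// => /(_ isT).
have -> : t *: z + (1 - t) *: x0 = t *: v + x0.
  by rewrite /v scalerBr scalerBl scale1r addrA addrAC.
have := min0 (t *: v + x0) => h1 h2.
rewrite -(ler_pM2l t0) mulrDr mulrBr mulrA divff ?gt_eqF// mul1r.
rewrite -/v in h2; lra.
Unshelve. all: by end_near. Qed.

Lemma gradientN f x :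
  differentiable (f : _ -> R^o) x -> gradient (- f) x = - gradient f x.
Proof.
move=> df; apply/rowP => i; rewrite !mxE deriveN//; exact: diff_derivable.
Qed.

Lemma minimizer_gradient f x :
  differentiable (f : _ -> R^o) x -> (forall z, f x <= f z) -> gradient f x = 0.
Proof.
move=> df fx; have cst0 : strongly_convex 0 (fun _ : 'rV[R]_d => 0 : R).
  by apply/strongly_convexP => *; lra.
apply: dot_eq0; apply/eqP; rewrite eq_le dot_ge0 andbT.
have min0 z : 0 + f x <= 0 + f z by rewrite !add0r.
(* With [S = 0] and a gradient step as [z], the bound says that the squared norm of the gradient is
   at most 0. *)
have := minimizer_lower_bound (x - gradient f x) cst0 df min0.
have -> : x - gradient f x - x = - gradient f x by rewrite addrAC subrr add0r.
rewrite dotNr; lra.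
Qed.

(** This is [minimizer_lower_bound] with [phi = 0]. *)
Lemma strong_minimizer s S x0 z : strongly_convex s S ->
  (forall x, S x0 <= S x) -> S x0 + s / 2 * dot (z - x0) (z - x0) <= S z.
Proof.
move=> cS min0; have d0 : differentiable ((fun=> 0) : 'rV[R]_d -> R^o) x0.
  exact: differentiable_cst.
have {}min0 x : S x0 + 0 <= S x + 0 by rewrite !addr0.
have := minimizer_lower_bound z cS d0 min0.
by rewrite minimizer_gradient// dot0l subr0.
Qed.

(** The sum [f + (- f)] is constant, so every point minimizes it, and [minimizer_lower_bound]
    applies with [S = f] and [phi = - f]. *)
Lemma admissible_lower_bound mu L f x z : admissible mu L f ->
  f x + dot (gradient f x) (z - x) + mu / 2 * dot (z - x) (z - x) <= f z.
Proof.
case=> df cf _; have min0 y : f x + (- f) x <= f y + (- f) y by rewrite !subrr.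
have := minimizer_lower_bound z cf (differentiableN (df x)) min0.
by rewrite gradientN// dotNl opprK.
Qed.

(** The same device with the roles of [f] and [- f] exchanged and modulus [- L]. *)
Lemma admissible_upper_bound mu L f x z : admissible mu L f ->
  f z <= f x + dot (gradient f x) (z - x) + L / 2 * dot (z - x) (z - x).
Proof.
case=> df _ /smooth_strongly_convex cf.
have min0 y : (- f) x + f x <= (- f) y + f y by rewrite !addNr.
have := minimizer_lower_bound z cf (df x) min0.
rewrite !opprfctE; lra.
Qed.

(* Says that [gradient f - (mu + L) / 2 *: id] is [(L - mu) / 2]-Lipschitz,
   before optimizing over [w]. Compare the two quadratic bounds at the points
   [m + w] and [m - w], where [m] is the midpoint of [x] and [y]. *)
Lemma admissible_gradient_dist mu L f x y w : admissible mu L f ->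
  dot (gradient f y - gradient f x - ((mu + L) / 2) *: (y - x)) w <=
  (L - mu) / 2 * (dot (y - x) (y - x) / 4 + dot w w).
Proof.
move=> af; set v := 2^-1 *: (y - x).
have yE : y = x + v + v.
  by rewrite -addrA -scalerDl (_ : 2^-1 + 2^-1 = 1) ?scale1r ?subrKC//; lra.
clearbody v; subst y; set y := x + v + v.
have vw : x + v + w - x = v + w by apply/rowP => i; rewrite !mxE; ring.
have vNw : x + v - w - x = v - w by apply/rowP => i; rewrite !mxE; ring.
have wNv : x + v + w - y = w - v by apply/rowP => i; rewrite !mxE; ring.
have NwNv : x + v - w - y = - w - v by apply/rowP => i; rewrite !mxE; ring.
have yx : y - x = v + v by apply/rowP => i; rewrite !mxE; ring.
(* In the sum of the four bounds all values of [f] cancel, and so do the gradient terms along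
   [v]. *)
have := admissible_upper_bound x (x + v + w) af.
have := admissible_lower_bound y (x + v + w) af.
have := admissible_lower_bound x (x + v - w) af.
have := admissible_upper_bound y (x + v - w) af.
rewrite vw vNw wNv NwNv yx !dotE (dotC w v); lra.
Qed.

(** Negative [s] and [c] are allowed: smoothness in [admissible_quadratic] is the case
    [- L <= - c]. *)
Lemma strongly_convex_quadratic s c a (g p : 'rV[R]_d) : s <= c ->
  strongly_convex s (fun x => a + dot g (x - p) + c / 2 * enorm (x - p) ^+ 2).
Proof.
move=> sc; apply/strongly_convexP => t x y /andP[t0 t1]; rewrite !sqr_enorm.
have -> : t *: x + (1 - t) *: y - p = t *: (x - p) + (1 - t) *: (y - p).
  by rewrite !scalerBr addrACA -opprD -scalerDl subrKC scale1r.
rewrite dot_convex_comb (dotDr (t *: _)) !(dotZr _ _ g).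
have -> : x - p - (y - p) = x - y by rewrite opprB addrA subrK.
have : 0 <= (c - s) / 2 * (t * (1 - t) * dot (x - y) (x - y)).
  by rewrite !mulr_ge0 ?invr_ge0 ?subr_ge0 ?dot_ge0.
lra.
Qed.

Lemma admissible_quadratic mu L c (p : 'rV[R]_d) : mu <= c <= L ->
  admissible mu L (fun x => c / 2 * enorm (x - p) ^+ 2).
Proof.
move=> /andP[muc cL]; split=> [x||].
- have -> : (fun x => c / 2 * enorm (x - p) ^+ 2) =
      c / 2 *: \sum_(i < d) ((fun x : 'rV[R]_d => x 0 i) - cst (p 0 i)) ^+ 2 :> (_ -> R^o).
    apply: funext => z; rewrite scalrfctE sqr_enorm fct_sumE; congr (_ * _).
    by apply: eq_bigr => i _; rewrite exprfctE !mxE expr2.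
  apply: differentiableZ; apply: differentiable_sum => i.
  apply: differentiableX; apply: differentiableB; last exact: differentiable_cst.
  exact: differentiable_coord.
- have := strongly_convex_quadratic 0 0 p muc.
  congr strongly_convex; apply: funext => x.
  by rewrite dot0l !add0r.
- apply/smooth_strongly_convex.
  have : - L <= - c by rewrite lerN2.
  move=> /(strongly_convex_quadratic 0 0 p).
  congr strongly_convex; apply: funext => x.
  by rewrite dot0l !add0r opprfctE !mulNr.
Qed.

End StrongConvexity.

(** * Upper bound on the bias of Legacy-GT *)

Lemma legacy_bias (R : realType) (d n : nat) (mu L eps : R) (I : instance n d)
    (xstar xhat : 'rV[R]_d) : 0 < mu -> mu < L -> (0 < n)%N ->
  admissible_instance mu L I ->
  argmin (objective I) = [set xstar] ->
  argmin (objective (legacy_instance mu L I)) = [set xhat] ->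
  enorm (snapshot I - xstar) <= eps ->
  enorm (xhat - xstar) <= (L / mu - 1) / (2 * n%:R) * eps.
Proof.
(* From here on [n] counts the survivors; the number of nodes is [n.+1]. *)
case: n I => // n I mu0 muL _ [afs af] Ixstar Ixhat y_eps.
case: I afs af Ixstar Ixhat y_eps => fs f y /= afs af Ixstar Ixhat y_eps.
pose S x := \sum_(j < n) fs j x.
have cS : strongly_convex (n%:R * mu) S.
  by apply: strongly_convex_sum => j; case: (afs j).
have xstar_min x : S xstar + f xstar <= S x + f x.
  have min : argmin (objective (Instance fs f y)) xstar by rewrite Ixstar.
  exact: min.
pose g := legacy mu L f y.
have xhat_min x : S xhat + g xhat <= S x + g x.
  have min : argmin (objective (legacy_instance mu L (Instance fs f y))) xhat.
    by rewrite Ixhat.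
  exact: min.
have cg : strongly_convex ((mu + L) / 2) g.
  have := strongly_convex_quadratic (f y) (gradient f y) y (lexx ((mu + L) / 2)).
  have -> : (mu + L) / 2 / 2 = (mu + L) / 4 by field.
  exact.
have [df _ _] := af.
have hS := minimizer_lower_bound xhat cS (df xstar) xstar_min.
have hF := strong_minimizer xstar (strongly_convexD cS cg) xhat_min.
have hL := admissible_gradient_dist xstar y _ af.
have l0 : 0 < L - mu by rewrite subr_gt0.
have n0 : 0 <= n%:R * mu by rewrite mulr_ge0// ltW.
pose m := n%:R * mu + (mu + L) / 2.
have m0 : 0 < m by rewrite /m; lra.
(* the weight optimizing [admissible_gradient_dist] *)
have {hL} := hL (- (m / (L - mu)) *: (xhat - xstar)).
move: hS hF; rewrite /g /legacy !sqr_enorm.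
have -> : xhat - y = (xhat - xstar) - (y - xstar) by rewrite opprB addrA subrK.
have -> : xstar - y = - (y - xstar) by rewrite opprB.
have -> : xstar - xhat = - (xhat - xstar) by rewrite opprB.
have := enorm_ge0 (xhat - xstar).
have := enorm_ge0 (y - xstar).
have := sqr_enorm (xhat - xstar).
have := sqr_enorm (y - xstar).
move: y_eps; move: (y - xstar) (xhat - xstar) => e u.
move: (enorm e) (enorm u) => E U.
rewrite !dotE (dotC e u).
move: (dot e e) (dot u u) (dot u e) => ee uu ue.
move: (dot _ u) (dot _ u) (dot _ e) (S xstar) (S xhat) => Gu Hu Ge Ss Sh.
move=> Eeps Eee Uuu E0 U0 hS hF hL.
pose X := Gu - Hu - (mu + L) / 2 * ue.
(* Adding [hS] and [hF] cancels the values of [S]; the quadratic terms in [u] add up to [m * uu]. *)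
have muX : m * uu <= - X by rewrite /X /m; lra.
have {}hL : - (m / (L - mu)) * X <=
    (L - mu) / 8 * ee + m * m / (2 * (L - mu)) * uu.
  apply: le_trans (le_trans _ hL) _; rewrite /X le_eqVlt; apply/orP; left; apply/eqP.
    by field; rewrite gt_eqF.
  by field; rewrite gt_eqF.
have {}hL : m * (- X) <= (L - mu) ^+ 2 / 8 * ee + m * m / 2 * uu.
  rewrite -(ler_pM2l l0) in hL; move: hL.
  rewrite [X in X <= _ -> _](_ : _ = m * - X); last by field; rewrite gt_eqF.
  by rewrite [X in _ <= X -> _](_ : _ = (L - mu) ^+ 2 / 8 * ee + m * m / 2 * uu)//;
    field; rewrite gt_eqF.
have {}muX : m * (m * uu) <= m * - X by rewrite ler_pM2l.
(* Chaining [muX] with [hL] leaves [m * m / 2 * uu <= (L - mu) ^+ 2 / 8 * ee]. *)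
have mUE : (2 * m * U) ^+ 2 <= ((L - mu) * E) ^+ 2.
  by rewrite !exprMn Eee Uuu; lra.
rewrite ler_pXn2r ?nnegrE ?mulr_ge0// in mUE; [|exact: ltW..].
have lE : (L - mu) * E <= (L - mu) * eps by rewrite ler_pM2l.
have mU : n.+1%:R * mu * U <= m * U.
  by rewrite ler_wpM2r// -natr1 /m; lra.
have -> : (L / mu - 1) / (2 * n.+1%:R) * eps = (L - mu) * eps / (2 * n.+1%:R * mu).
  by field; rewrite ?gt_eqF.
by rewrite ler_pdivlMr ?mulr_gt0//; lra.
Qed.

(** * Minimizers of the quadratic instances and the two-point argument *)

Lemma argmin_quadratic (R : realType) (d : nat) (F : 'rV[R]_d -> R) (K m : R)
    (x0 : 'rV[R]_d) : 0 < m -> (forall x, F x = K + m * dot (x - x0) (x - x0)) ->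
  argmin F = [set x0].
Proof.
move=> m0 FE; apply/seteqP; split=> [x|_ ->] /=; last first.
  move=> z; rewrite !FE subrr dot0l mulr0 addr0 lerDl.
  by rewrite mulr_ge0 ?dot_ge0 ?ltW.
move=> /(_ x0); rewrite !FE subrr dot0l mulr0 addr0 gerDl pmulr_rle0// => le0.
apply/eqP; rewrite -subr_eq0; apply/eqP/dot_eq0/eqP.
by rewrite eq_le le0 dot_ge0.
Qed.

Lemma argmin_quadratic_instance (R : realType) (n d : nat) (mu c : R)
    (p : 'rV[R]_d) : 0 < mu -> 0 < c ->
  argmin (objective (Instance (fun _ : 'I_n.-1 => fun x => mu / 2 * enorm (x - p) ^+ 2)
                       (fun x => c / 2 * enorm (x - 0) ^+ 2) 0)) =
  [set (n.-1%:R * mu / (n.-1%:R * mu + c)) *: p].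
Proof.
move=> mu0 c0; set k : R := n.-1%:R * mu.
have k0 : 0 <= k by rewrite mulr_ge0// ltW.
have kc0 : 0 < k + c by lra.
(* The constants come from completing the square in [k / 2 * |x - p|^2 + c / 2 * |x|^2]. *)
apply: (@argmin_quadratic _ _ _ (k * c / (k + c) / 2 * dot p p) ((k + c) / 2)).
  by lra.
move=> x; rewrite /objective /= !sqr_enorm sumr_const card_ord -[_ *+ n.-1]mulr_natl !mulrA -/k.
rewrite subr0 !dotE (dotC p x); field.
by rewrite gt_eqF.
Qed.

(** If both distances were below [r], then [|a - b|^2 <= 2 * |a|^2 + 2 * |b|^2] with [a = u - x] and
    [b = u - y] would give [|x - y|^2 < 4 * r^2]. *)
Lemma enorm_split_lower_bound (R : realType) (d : nat) (u x y : 'rV[R]_d) (r : R) :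
  0 <= r -> 2 * r <= enorm (x - y) ->
  r <= enorm (u - x) \/ r <= enorm (u - y).
Proof.
move=> r0 xy; have [|ux] := lerP r (enorm (u - x)); first by left.
have [|uy] := lerP r (enorm (u - y)); first by right.
have xy2 : (2 * r) ^+ 2 <= enorm (x - y) ^+ 2.
  by rewrite ler_pXn2r// nnegrE ?enorm_ge0// mulr_ge0.
have ux2 : enorm (u - x) ^+ 2 < r ^+ 2 by rewrite ltr_pXn2r// nnegrE ?enorm_ge0.
have uy2 : enorm (u - y) ^+ 2 < r ^+ 2 by rewrite ltr_pXn2r// nnegrE ?enorm_ge0.
have xyE : x - y = (u - y) - (u - x) by apply/rowP => i; rewrite !mxE; ring.
move: (dot_ge0 ((u - x) + (u - y))) xy2 ux2 uy2; rewrite xyE; move: (u - x) (u - y) => a b; rewrite !sqr_enorm !dotE; lra.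
Qed.

(** * Choice of constants and of the two instances *)

Theorem theorem2 (R : realType) :
  exists c C : R, 0 < c /\ 0 < C /\
  forall (mu L : R) (n : nat), 0 < mu -> mu < L -> (2 <= n)%N ->
  let kappa := L / mu in
  exists a b : R, 0 < a /\ 0 < b /\
  forall d : nat, (1 <= d)%N ->
  (* the two instances, and the lower bound for every memory-based method *)
  (forall (Mem : Type) (M : 'rV[R]_d -> 'rV[R]_d -> Mem) (eps : R), 0 < eps ->
   exists (fs : 'I_n.-1 -> 'rV[R]_d -> R) (f f' : 'rV[R]_d -> R)
          (y xstar xstar' : 'rV[R]_d),
     let I := Instance fs f y in
     let I' := Instance fs f' y in
     admissible_instance mu L I /\ admissible_instance mu L I' /\
     gradient f y = gradient f' y /\
     argmin (objective I) = [set xstar] /\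
     argmin (objective I') = [set xstar'] /\
     a * eps <= enorm (y - xstar) <= b * eps /\
     a * eps <= enorm (y - xstar') <= b * eps /\
     enorm (xstar - xstar') = (L - mu) * eps / ((n%:R - 1) * mu + L) /\
     (forall A : Mem -> ('I_n.-1 -> 'rV[R]_d -> R) -> 'rV[R]_d,
        c * ((kappa - 1) * eps / (n%:R + kappa))
          <= enorm (memory_limit M A I - xstar) \/
        c * ((kappa - 1) * eps / (n%:R + kappa))
          <= enorm (memory_limit M A I' - xstar'))) /\
  (* the guarantee of Legacy-GT *)
  (forall (eps : R) (I : instance n d) (xstar xhat : 'rV[R]_d),
     admissible_instance mu L I ->
     argmin (objective I) = [set xstar] ->
     argmin (objective (legacy_instance mu L I)) = [set xhat] ->
     enorm (snapshot I - xstar) <= eps ->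
     enorm (xhat - xstar) <= (kappa - 1) / (2 * n%:R) * eps) /\
  (* ... exceeds the lower bound by a factor of at most C * kappa *)
  (forall eps : R, 0 < eps ->
     (kappa - 1) / (2 * n%:R) * eps
       <= C * kappa * (c * ((kappa - 1) * eps / (n%:R + kappa)))).

Proof.
(* The factor 1/2 is the loss in the two-point argument; [C = 2] works because
   [n + kappa <= 2 * n * kappa]. *)
exists (1 / 2), 2; do 2![split; first by []].
move=> mu L n mu0 muL n2 kappa.
have L0 : 0 < L by exact: lt_trans muL.
have n1E : n.-1%:R = n%:R - 1 :> R.
  by rewrite -subn1 natrB// ltnW.
have n0 : 2 <= n%:R :> R by rewrite ler_nat.
have nmu0 : 0 < (n%:R - 1) * mu by rewrite mulr_gt0//; lra.
have den0 : 0 < (n%:R - 1) * mu + L by lra.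
have kappa1 : 1 < kappa by rewrite /kappa ltr_pdivlMr// mul1r.
(* These are the exact ratios of [|y - xstar|] to [eps] for departing curvature [L] and [mu]
   respectively. *)
exists (n%:R * mu / ((n%:R - 1) * mu + L)), 1.
split; first by rewrite divr_gt0// mulr_gt0//; lra.
split=> // d d1; split=> [Mem M eps eps0|]; last split.
(* With this length the minimizer for curvature [mu], [((n - 1) / n) *: p], has norm exactly
   [eps]. *)
- pose p : 'rV[R]_d := (n%:R * eps / (n%:R - 1)) *: delta_mx 0 (Ordinal d1).
  have pE a : enorm (a *: p) = `|a| * (n%:R * eps / (n%:R - 1)).
    rewrite !enormZ enorm_delta mulr1; congr (_ * _); apply: ger0_norm.
    by rewrite divr_ge0 ?mulr_ge0//; lra.
  pose r c := (n%:R - 1) * mu / ((n%:R - 1) * mu + c).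
  have yE c : mu <= c ->
      enorm (0 - r c *: p) = n%:R * mu / ((n%:R - 1) * mu + c) * eps.
    move=> muc; rewrite sub0r -scaleNr pE normrN ger0_norm /r.
      by field; do ?[split]; rewrite gt_eqF//; lra.
    by rewrite divr_ge0//; lra.
  pose q c : 'rV[R]_d -> R := fun x => c / 2 * enorm (x - 0) ^+ 2.
  have q0 c : mu <= c <= L -> gradient (q c) 0 = 0.
    move=> cL; have [dq _ _] := admissible_quadratic (0 : 'rV[R]_d) cL.
    apply: minimizer_gradient; first exact: dq.
    move=> z; rewrite /q subrr sqr_enorm dot0l mulr0 mulr_ge0 ?sqr_ge0// divr_ge0//; lra.
  exists (fun _ x => mu / 2 * enorm (x - p) ^+ 2), (q mu), (q L), 0.
  exists (r mu *: p), (r L *: p) => I I'.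
  have mumu : mu <= mu <= L by rewrite lexx ltW.
  have muLL : mu <= L <= L by rewrite lexx ltW.
  have grad_eq : gradient (q mu) 0 = gradient (q L) 0 by rewrite !q0.
  have dist : enorm (r mu *: p - r L *: p) = (L - mu) * eps / ((n%:R - 1) * mu + L).
    rewrite -scalerBl pE ger0_norm.
      rewrite /r; field; do ?[split]; rewrite ?gt_eqF//; lra.
    rewrite subr_ge0 /r ler_pM2l// lef_pV2 ?posrE//; lra.
  split; first by split=> [j|]; exact: admissible_quadratic.
  split; first by split=> [j|]; exact: admissible_quadratic.
  split; first exact: grad_eq.
  split; first by rewrite argmin_quadratic_instance// n1E.
  split; first by rewrite argmin_quadratic_instance// n1E.
  split.
    rewrite yE//; apply/andP; split; rewrite ler_pM2r//.
      rewrite ler_pM2l ?mulr_gt0//; last lra.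
      rewrite lef_pV2 ?posrE//; lra.
    by rewrite ler_pdivrMr; lra.
  split.
    rewrite (yE L (ltW muL)) lexx ler_pM2r//=.
    rewrite ler_pdivrMr//; lra.
  split; first exact: dist.
  move=> A; have -> : memory_limit M A I' = memory_limit M A I.
    by rewrite /memory_limit /= grad_eq.
  have nk0 : 0 < n%:R + kappa by lra.
  apply: enorm_split_lower_bound.
    by rewrite mulr_ge0// divr_ge0 ?mulr_ge0//; lra.
  (* Clearing [kappa] gives the denominator [n * mu + L], larger by [mu] than the one in [dist]. *)
  have -> : 2 * (1 / 2 * ((kappa - 1) * eps / (n%:R + kappa))) =
      (L - mu) * eps / (n%:R * mu + L).
    by rewrite /kappa; field; rewrite !gt_eqF//; lra.
  by rewrite dist ler_pM2l ?mulr_gt0 ?subr_gt0// lef_pV2 ?posrE//; lra.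
- move=> eps I xstar xhat; exact: (legacy_bias mu0 muL (ltnW n2)).
- move=> eps eps0.
  have nk0 : 0 < n%:R + kappa by lra.
  have -> : 2 * kappa * (1 / 2 * ((kappa - 1) * eps / (n%:R + kappa))) =
      (kappa - 1) * eps * (kappa / (n%:R + kappa)).
    by field; rewrite gt_eqF.
  rewrite mulrAC ler_pM2l ?mulr_gt0 ?subr_gt0//.
  rewrite ler_pdivlMr// mulrC ler_pdivrMr ?mulr_gt0//; last lra.
  nra.
Qed.
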